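(* Let $\mathcal{R}$ be an LCTRS and suppose $\Pi X.\,s\,[\exists\vec{x}.\varphi]\to^*_{\mathcal R}\Pi Y.\,t\,[\exists\vec{y}.\psi]$. Then (1) for each $u\in[\![\Pi X.\,s\,[\exists\vec{x}.\varphi]]\!]$ there exists $v\in[\![\Pi Y.\,t\,[\exists\vec{y}.\psi]]\!]$ such that $u\to^*_{[\![\mathcal R]\!]}v$; and (2) for each $v\in[\![\Pi Y.\,t\,[\exists\vec{y}.\psi]]\!]$ there exists $u\in[\![\Pi X.\,s\,[\exists\vec{x}.\varphi]]\!]$ such that $u\to^*_{[\![\mathcal R]\!]}v$.
   Context: Terms are built over a sorted signature whose function symbols are split into theory symbols (whose argument and result sorts are theory sorts) and term symbols, and a set $\mathcal{V}$ of sorted variables; theory sorts and symbols are interpreted in a fixed model $\mathcal{M}$. Every element of the interpretation of each theory sort is a constant symbol, called a value; $\mathcal{V}al$ denotes the set of values. There is a theory sort of Booleans with standard interpretation and the usual connectives. A constraint is a Boolean-sorted term built from theory symbols and variables; a (possibly existentially quantified) formula is valid if it is true under all valuations of its free variables in $\mathcal{M}$ and satisfiable if true under some. $\mathcal{V}ar(\cdot)$ is the set of variables. A substitution $\sigma$ is a sort-preserving map from variables to terms with finite domain $\mathcal{D}om(\sigma)=\{x\mid \sigma(x)\neq x\}$; $\mathcal{V}Dom(\sigma)=\{x\mid\sigma(x)\in\mathcal{V}al\}$; $\sigma$ is $X$-valued if $\sigma(X)\subseteq\mathcal{V}al$. An existential constraint $\exists\vec{x}.\varphi$ is a sequence of variables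 $\vec x$ together with a constraint $\varphi$ with $\{\vec x\}\subseteq\mathcal{V}ar(\varphi)$; its free variables are $\mathcal{FV}ar(\exists\vec x.\varphi)=\mathcal{V}ar(\varphi)\setminus\{\vec x\}$. For a substitution $\sigma$, $\sigma\vDash_{\mathcal M}\exists\vec x.\varphi$ means $\sigma$ is $\mathcal{FV}ar(\exists\vec x.\varphi)$-valued and $(\exists\vec x.\varphi)\sigma$ is valid. An existentially constrained term $\Pi X.\,s\,[\exists\vec x.\varphi]$ consists of a set $X$ of variables, a term $s$ and an existential constraint with $\mathcal{FV}ar(\exists\vec x.\varphi)\subseteq X\subseteq\mathcal{V}ar(s)$ and $\{\vec x\}\cap\mathcal{V}ar(s)=\emptyset$; it is satisfiable if $\exists\vec x.\varphi$ is satisfiable. A constrained rewrite rule $\rho\colon \Pi Z.\,\ell\to r\,[\pi]$ consists of a set $Z$ of variables, terms $\ell,r$ of the same sort and a constraint $\pi$ with $\mathcal{V}ar(\pi)\cup(\mathcal{V}ar(r)\setminus\mathcal{V}ar(\ell))\subseteq Z$; it is left-linear if $\ell$ is linear; $\mathcal{E}x\mathcal{V}ar(\rho)=\mathcal{V}ar(r)\setminus\mathcal{V}ar(\ell)$. Let $\Pi X.\,s\,[\exists\vec x.\varphi]$ be satisfiable, $\rho$ left-linear with $\mathcal{V}ar(\rho)\cap\mathcal{V}ar(s,\varphi)=\emptyset$, and $\{\vec z\}=\mathcal{V}ar(\pi)\setminus\mathcal{V}ar(\ell)$. The term has a $\rho$-redex at position $p$ of $s$ using $\gamma$ if (i) $\mathcal{D}om(\gamma)=\mathcal{V}ar(\ell)$,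 (ii) $s|_p=\ell\gamma$, (iii) $\gamma(x)\in\mathcal{V}al\cup X$ for all $x\in\mathcal{V}ar(\ell)\cap Z$, and (iv) $(\exists\vec x.\varphi)\Rightarrow(\exists\vec z.\pi\gamma)$ is valid; then, with $t=s[r\gamma]_p$, $\psi=\varphi\wedge\pi\gamma$, $\{\vec y\}=\mathcal{V}ar(\psi)\setminus\mathcal{V}ar(t)$, $Y=\mathcal{E}x\mathcal{V}ar(\rho)\cup(X\cap\mathcal{V}ar(t))$, there is a most general rewrite step $\Pi X.\,s\,[\exists\vec x.\varphi]\to^p_{\rho,\gamma}\Pi Y.\,t\,[\exists\vec y.\psi]$. One writes $\to_\rho$ if such a step exists for some position, some $\gamma$ and some renamed variant of $\rho$ whose variables are disjoint from those of the source term. An LCTRS $\mathcal R$ is a set of left-linear constrained rewrite rules (including the calculation rules for theory symbols); $\to_{\mathcal R}=\bigcup_{\rho\in\mathcal R}\to_\rho$ and $\to^*_{\mathcal R}$ is its reflexive–transitive closure. For a set $R$ of pairs of ordinary terms, $u\to^p_R v$ means there are $\langle l,r'\rangle\in R$ and a substitution $\theta$ with $u|_p=l\theta$ and $v=u[r'\theta]_p$; $\to_R$ is the union over all positions and $\to^*_R$ its reflexive–transitive closure. Interpretation of a constrained term: $[\![\Pi X.\,s\,[\exists\vec x.\varphi]]\!]=\{s\sigma\mid\sigma(X)\subseteq\mathcal{V}al,\ \sigma\vDash_{\mathcal M}\exists\vec x.\varphi\}$. Interpretation of a rule $\rho\colon\Pi Z.\,\ell\to r\,[\pi]$: $[\![\rho]\!]=\{\langle\ell\sigma,r\sigma\rangle\mid\mathcal{D}om(\sigma)=\mathcal{V}Dom(\sigma)=Z\cap\mathcal{V}ar(\ell,r),\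 \sigma\vDash_{\mathcal M}\exists\vec z'.\pi\}$ where $\{\vec z'\}=\mathcal{V}ar(\pi)\setminus\mathcal{V}ar(\ell,r)$; $[\![\mathcal R]\!]=\bigcup_{\rho\in\mathcal R}[\![\rho]\!]$.
   Formalization: The sets X of constrained terms and Z of rules are required to consist of theory-sorted variables (otherwise part (2) fails, e.g. for f(x) → a with a non-theory variable x in X), and theory sorts are interpreted by nonempty sets. *)

(* Defs.v *)
From mathcomp Require Import all_boot.
From mathcomp Require Import boolp classical_sets cardinality.
From Stdlib Require List.
From Stdlib Require Import Relation_Operators.

Set Implicit Arguments.
Unset Strict Implicit.
Unset Printing Implicit Defensive.

Local Open Scope classical_set_scope.

(* [value_sort a = tau] says that [a] is an element of the interpretation of
   the theory sort [tau]; these elements are themselves constant symbols, so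
   [value] is part of the signature.  The full set of theory symbols consists
   of [value] and [theory_sym]: the latter are the theory symbols that are not
   values. *)
Record signature := Signature {
  theory_sort : Type;
  term_sort : Type;
  bool_sort : theory_sort;
  var : eqType;
  var_sort : var -> theory_sort + term_sort;
  value : Type;
  value_sort : value -> theory_sort;
  theory_sym : Type;
  theory_dom : theory_sym -> seq theory_sort;
  theory_cod : theory_sym -> theory_sort;
  term_sym : Type;
  term_dom : term_sym -> seq (theory_sort + term_sort);
  term_cod : term_sym -> theory_sort + term_sort;
  not_sym : theory_sym;
  and_sym : theory_sym;
  or_sym : theory_sym;
  imp_sym : theory_sym;
  iff_sym : theory_sym;
  not_dom : theory_dom not_sym = [:: bool_sort];
  not_cod : theory_cod not_sym = bool_sort;
  and_dom : theory_dom and_sym = [:: bool_sort; bool_sort];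
  and_cod : theory_cod and_sym = bool_sort;
  or_dom : theory_dom or_sym = [:: bool_sort; bool_sort];
  or_cod : theory_cod or_sym = bool_sort;
  imp_dom : theory_dom imp_sym = [:: bool_sort; bool_sort];
  imp_cod : theory_cod imp_sym = bool_sort;
  iff_dom : theory_dom iff_sym = [:: bool_sort; bool_sort];
  iff_cod : theory_cod iff_sym = bool_sort
}.

Definition sort (Sg : signature) : Type := (theory_sort Sg + term_sort Sg)%type.

(* The values of [interp f] on argument lists that do not match the arity of
   [f] are irrelevant. *)
Record model (Sg : signature) := Model {
  interp : theory_sym Sg -> seq (value Sg) -> value Sg;
  interp_sort : forall (f : theory_sym Sg) (vs : seq (value Sg)),
    map (@value_sort Sg) vs = theory_dom f ->
    value_sort (interp f vs) = theory_cod f;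
  carrier_nonempty : forall tau : theory_sort Sg,
    exists a : value Sg, value_sort a = tau;
  vbool : bool -> value Sg;
  vbool_inj : injective vbool;
  vbool_onto : forall a : value Sg,
    value_sort a = bool_sort Sg <-> exists b : bool, a = vbool b;
  interp_not : forall a : bool,
    interp (not_sym Sg) [:: vbool a] = vbool (~~ a);
  interp_and : forall a b : bool,
    interp (and_sym Sg) [:: vbool a; vbool b] = vbool (a && b);
  interp_or : forall a b : bool,
    interp (or_sym Sg) [:: vbool a; vbool b] = vbool (a || b);
  interp_imp : forall a b : bool,
    interp (imp_sym Sg) [:: vbool a; vbool b] = vbool (a ==> b);
  interp_iff : forall a b : bool,
    interp (iff_sym Sg) [:: vbool a; vbool b] = vbool (a == b)
}.

Inductive symbol (Sg : signature) : Type :=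
| ValSym of value Sg
| ThSym of theory_sym Sg
| TeSym of term_sym Sg.

Definition sym_dom (Sg : signature) (f : symbol Sg) : seq (sort Sg) :=
  match f with
  | ValSym _ => [::]
  | ThSym g => [seq inl tau | tau <- theory_dom g]
  | TeSym g => term_dom g
  end.

Definition sym_cod (Sg : signature) (f : symbol Sg) : sort Sg :=
  match f with
  | ValSym a => inl (value_sort a)
  | ThSym g => inl (theory_cod g)
  | TeSym g => term_cod g
  end.

Inductive term (Sg : signature) : Type :=
| Var of var Sg
| Fun of symbol Sg & seq (term Sg).

Inductive has_sort (Sg : signature) : term Sg -> sort Sg -> Prop :=
| has_sort_var (x : var Sg) : has_sort (Var x) (var_sort x)
| has_sort_fun (f : symbol Sg) (ts : seq (term Sg)) :
    List.Forall2 (@has_sort Sg) ts (sym_dom f) ->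
    has_sort (Fun f ts) (sym_cod f).

Fixpoint vars (Sg : signature) (t : term Sg) : seq (var Sg) :=
  match t with
  | Var x => [:: x]
  | Fun _ ts => flatten [seq vars u | u <- ts]
  end.

Definition Vars (Sg : signature) (t : term Sg) : set (var Sg) :=
  [set x | x \in vars t].

Definition linear (Sg : signature) (t : term Sg) : Prop := uniq (vars t).

Definition theory_vars (Sg : signature) : set (var Sg) :=
  [set x | exists tau : theory_sort Sg, var_sort x = inl tau].

Definition Val (Sg : signature) : set (term Sg) :=
  [set t | exists a : value Sg, t = Fun (ValSym a) [::]].
Arguments Val {Sg}.

Definition Dom (Sg : signature) (s : var Sg -> term Sg) : set (var Sg) :=
  [set x | s x <> Var x].

Definition VDom (Sg : signature) (s : var Sg -> term Sg) : set (var Sg) :=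
  [set x | Val (s x)].

Record substitution (Sg : signature) := Substitution {
  subst_fun :> var Sg -> term Sg;
  subst_sorted : forall x : var Sg, has_sort (subst_fun x) (var_sort x);
  subst_finite : finite_set (Dom subst_fun)
}.

Fixpoint subst (Sg : signature) (s : var Sg -> term Sg) (t : term Sg) :
    term Sg :=
  match t with
  | Var x => s x
  | Fun f ts => Fun f [seq subst s u | u <- ts]
  end.

Definition valued (Sg : signature) (X : set (var Sg))
    (s : var Sg -> term Sg) : Prop := s @` X `<=` Val.

(* Positions are sequences of argument indices, counted from 0. *)
Fixpoint subterm_at (Sg : signature) (t : term Sg) (p : seq nat) :
    option (term Sg) :=
  match p with
  | [::] => Some t
  | i :: q =>
      match t with
      | Var _ => None
      | Fun _ ts => if onth ts i is Some u then subterm_at u q else None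
      end
  end.

(* [replace_at t p u] is t[u]_p; it is only used when [p] is a position of
   [t]. *)
Fixpoint replace_at (Sg : signature) (t : term Sg) (p : seq nat)
    (u : term Sg) : term Sg :=
  match p with
  | [::] => u
  | i :: q =>
      match t with
      | Var _ => t
      | Fun f ts =>
          if onth ts i is Some w
          then Fun f (take i ts ++ replace_at w q u :: drop i.+1 ts)
          else t
      end
  end.

Fixpoint theory_term (Sg : signature) (t : term Sg) : bool :=
  match t with
  | Var _ => true
  | Fun (TeSym _) _ => false
  | Fun _ ts => all (@theory_term Sg) ts
  end.

Definition is_constraint (Sg : signature) (phi : term Sg) : Prop :=
  has_sort phi (inl (bool_sort Sg)) /\ theory_term phi.

Definition andt (Sg : signature) (phi psi : term Sg) : term Sg :=
  Fun (ThSym (and_sym Sg)) [:: phi; psi].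

(* The value of a valuation at a variable of a non-theory sort is irrelevant. *)
Record valuation (Sg : signature) := Valuation {
  val_fun :> var Sg -> value Sg;
  val_sorted : forall (x : var Sg) (tau : theory_sort Sg),
    var_sort x = inl tau -> value_sort (val_fun x) = tau
}.

(* The clause for term symbols is a dummy: they do not occur in constraints. *)
Fixpoint eval (Sg : signature) (M : model Sg) (nu : var Sg -> value Sg)
    (t : term Sg) : value Sg :=
  match t with
  | Var x => nu x
  | Fun (ValSym a) _ => a
  | Fun (ThSym f) ts => interp M f [seq eval M nu u | u <- ts]
  | Fun (TeSym _) _ => vbool M false
  end.

Record exformula (Sg : signature) := Ex {
  bvars : seq (var Sg);
  body : term Sg
}.

Definition BVar (Sg : signature) (e : exformula Sg) : set (var Sg) :=
  [set x | x \in bvars e].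

Definition FVar (Sg : signature) (e : exformula Sg) : set (var Sg) :=
  Vars (body e) `\` BVar e.

Definition is_exconstraint (Sg : signature) (e : exformula Sg) : Prop :=
  is_constraint (body e) /\ BVar e `<=` Vars (body e).

(* A substitution acts on the free variables only; no renaming of bound
   variables is performed, as this is only used for substitutions that map
   the free variables to values. *)
Definition exsubst (Sg : signature) (s : var Sg -> term Sg)
    (e : exformula Sg) : exformula Sg :=
  Ex (bvars e) (subst (fun x => if x \in bvars e then Var x else s x) (body e)).

Definition holds (Sg : signature) (M : model Sg) (nu : valuation Sg)
    (e : exformula Sg) : Prop :=
  exists nu' : valuation Sg,
    (forall x, x \notin bvars e -> nu' x = nu x) /\
    eval M nu' (body e) = vbool M true.

Definition valid (Sg : signature) (M : model Sg) (e : exformula Sg) : Prop :=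
  forall nu : valuation Sg, holds M nu e.

Definition valid_imp (Sg : signature) (M : model Sg)
    (e1 e2 : exformula Sg) : Prop :=
  forall nu : valuation Sg, holds M nu e1 -> holds M nu e2.

Definition satisfiable (Sg : signature) (M : model Sg)
    (e : exformula Sg) : Prop :=
  exists nu : valuation Sg, holds M nu e.

Definition models (Sg : signature) (M : model Sg) (s : substitution Sg)
    (e : exformula Sg) : Prop :=
  valued (FVar e) s /\ valid M (exsubst s e).

(* The Pi-bound variables of a constrained term or of a rule stand for values
   and therefore have theory sorts. *)
Record cterm (Sg : signature) := CTerm {
  ct_set : set (var Sg);
  ct_term : term Sg;
  ct_con : exformula Sg;
  ct_set_theory : ct_set `<=` @theory_vars Sg;
  ct_term_sorted : exists a : sort Sg, has_sort ct_term a;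
  ct_con_wf : is_exconstraint ct_con;
  ct_fvar : FVar ct_con `<=` ct_set;
  ct_set_vars : ct_set `<=` Vars ct_term;
  ct_bvar : BVar ct_con `&` Vars ct_term = set0
}.

Record rule (Sg : signature) := Rule {
  rl_set : set (var Sg);
  rl_lhs : term Sg;
  rl_rhs : term Sg;
  rl_con : term Sg;
  rl_set_theory : rl_set `<=` @theory_vars Sg;
  rl_sorted : exists a : sort Sg, has_sort rl_lhs a /\ has_sort rl_rhs a;
  rl_con_wf : is_constraint rl_con;
  rl_vars : Vars rl_con `|` (Vars rl_rhs `\` Vars rl_lhs) `<=` rl_set
}.

Definition left_linear (Sg : signature) (rho : rule Sg) : Prop :=
  linear (rl_lhs rho).

Definition ExVar (Sg : signature) (rho : rule Sg) : set (var Sg) :=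
  Vars (rl_rhs rho) `\` Vars (rl_lhs rho).

Definition rule_vars (Sg : signature) (rho : rule Sg) : set (var Sg) :=
  Vars (rl_lhs rho) `|` Vars (rl_rhs rho) `|` Vars (rl_con rho).

Definition vars_diff (Sg : signature) (xs ys : seq (var Sg)) : seq (var Sg) :=
  [seq x <- undup xs | x \notin ys].

Definition is_redex (Sg : signature) (M : model Sg) (S : cterm Sg)
    (rho : rule Sg) (p : seq nat) (gamma : substitution Sg) : Prop :=
  [/\ Dom gamma = Vars (rl_lhs rho),
      subterm_at (ct_term S) p = Some (subst gamma (rl_lhs rho)),
      (forall x, (Vars (rl_lhs rho) `&` rl_set rho) x ->
         (Val `|` (@Var Sg @` ct_set S)) (gamma x))
    & valid_imp M (ct_con S)
        (Ex (vars_diff (vars (rl_con rho)) (vars (rl_lhs rho)))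
            (subst gamma (rl_con rho)))].

Definition mg_step (Sg : signature) (M : model Sg) (rho : rule Sg)
    (p : seq nat) (gamma : substitution Sg) (S T : cterm Sg) : Prop :=
  [/\ satisfiable M (ct_con S),
      left_linear rho,
      rule_vars rho `&` (Vars (ct_term S) `|` Vars (body (ct_con S))) = set0
    & is_redex M S rho p gamma] /\
  [/\ ct_term T = replace_at (ct_term S) p (subst gamma (rl_rhs rho)),
      body (ct_con T) = andt (body (ct_con S)) (subst gamma (rl_con rho)),
      BVar (ct_con T) = Vars (body (ct_con T)) `\` Vars (ct_term T)
    & ct_set T = ExVar rho `|` (ct_set S `&` Vars (ct_term T))].

Definition is_variant (Sg : signature) (rho rho' : rule Sg) : Prop :=
  exists delta : var Sg -> var Sg,
    [/\ bijective delta, forall x, var_sort (delta x) = var_sort x,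
        rl_set rho' = delta @` rl_set rho
      & [/\ rl_lhs rho' = subst (fun x => Var (delta x)) (rl_lhs rho),
            rl_rhs rho' = subst (fun x => Var (delta x)) (rl_rhs rho)
          & rl_con rho' = subst (fun x => Var (delta x)) (rl_con rho)]].

Definition cstep_rule (Sg : signature) (M : model Sg) (rho : rule Sg)
    (S T : cterm Sg) : Prop :=
  exists (rho' : rule Sg) (p : seq nat) (gamma : substitution Sg),
    is_variant rho rho' /\ mg_step M rho' p gamma S T.

Definition cstep (Sg : signature) (M : model Sg) (R : set (rule Sg))
    (S T : cterm Sg) : Prop :=
  exists rho : rule Sg, R rho /\ cstep_rule M rho S T.

Definition csteps (Sg : signature) (M : model Sg) (R : set (rule Sg)) :
    cterm Sg -> cterm Sg -> Prop :=
  clos_refl_trans (cterm Sg) (cstep M R).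

Definition is_equality (Sg : signature) (M : model Sg) (tau : theory_sort Sg)
    (e : theory_sym Sg) : Prop :=
  [/\ theory_dom e = [:: tau; tau], theory_cod e = bool_sort Sg
    & forall a b : value Sg, value_sort a = tau -> value_sort b = tau ->
        interp M e [:: a; b] = vbool M true <-> a = b].

(* Pi {x1,...,xn,y}. f(x1,...,xn) -> y [y = f(x1,...,xn)] *)
Definition is_calculation_rule (Sg : signature) (M : model Sg)
    (f : theory_sym Sg) (rho : rule Sg) : Prop :=
  exists (xs : seq (var Sg)) (y : var Sg) (e : theory_sym Sg),
    let fxs := Fun (ThSym f) [seq Var x | x <- xs] in
    [/\ uniq (y :: xs) : Prop, is_equality M (theory_cod f) e,
        rl_set rho = [set x | x \in y :: xs]
      & [/\ rl_lhs rho = fxs, rl_rhs rho = Var y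
          & rl_con rho = Fun (ThSym e) [:: Var y; fxs]]].

Definition is_LCTRS (Sg : signature) (M : model Sg) (R : set (rule Sg)) :
    Prop :=
  (forall rho, R rho -> left_linear rho) /\
  (forall f : theory_sym Sg, exists rho, R rho /\ is_calculation_rule M f rho).

Definition step (Sg : signature) (P : set (term Sg * term Sg))
    (u v : term Sg) : Prop :=
  exists (p : seq nat) (l r : term Sg) (theta : substitution Sg),
    [/\ P (l, r), subterm_at u p = Some (subst theta l)
      & v = replace_at u p (subst theta r)].

Definition steps (Sg : signature) (P : set (term Sg * term Sg)) :
    term Sg -> term Sg -> Prop :=
  clos_refl_trans (term Sg) (step P).

Definition cterm_interp (Sg : signature) (M : model Sg) (S : cterm Sg) :
    set (term Sg) :=
  [set u | exists s : substitution Sg,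
     [/\ u = subst s (ct_term S), valued (ct_set S) s & models M s (ct_con S)]].

Definition rule_interp (Sg : signature) (M : model Sg) (rho : rule Sg) :
    set (term Sg * term Sg) :=
  [set lr | exists s : substitution Sg,
     [/\ lr = (subst s (rl_lhs rho), subst s (rl_rhs rho)),
         Dom s = VDom s,
         VDom s = rl_set rho `&` (Vars (rl_lhs rho) `|` Vars (rl_rhs rho))
       & models M s
           (Ex (vars_diff (vars (rl_con rho))
                  (vars (rl_lhs rho) ++ vars (rl_rhs rho)))
               (rl_con rho))]].

Definition rules_interp (Sg : signature) (M : model Sg) (R : set (rule Sg)) :
    set (term Sg * term Sg) :=
  \bigcup_(rho in R) rule_interp M rho.

(* Main.v *)
Require Import Defs.
From HB Require Import structures.
From mathcomp Require Import all_boot.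
From mathcomp Require Import boolp classical_sets cardinality.
From Stdlib Require Import Relation_Operators.

(** An element of the interpretation of [Pi X. s [ex x. phi]] is given by a
    substitution [sigma] together with one valuation [nu] that agrees with
    [sigma] on [X] and makes [phi] true.  For a most general step to
    [Pi Y. t [ex y. phi /\ pi gamma]], every pair [(sigma, nu)] that agrees on
    [X] and on the extra variables of the rule and makes [phi /\ pi gamma] true
    yields an instance of the source, an instance of the target, and a rewrite
    step between them.  Forwards, the redex condition changes [nu] on fresh
    variables only so that [pi gamma] becomes true, and [sigma] is redefined by
    [nu] on the extra variables of the rule.  Backwards, [sigma] is redefined by
    [nu] on the variables of [X] that do not occur in [t]. *)

Set Implicit Arguments.
Unset Strict Implicit.
Unset Printing Implicit Defensive.

Local Open Scope classical_set_scope.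

HB.instance Definition _ (Sg : signature) := gen_eqMixin (term Sg).

Section Terms.
Variable Sg : signature.
Implicit Types (s : var Sg -> term Sg) (t u w : term Sg) (p : seq nat).

Lemma term_ind_in (P : term Sg -> Prop) :
  (forall x, P (Var x)) ->
  (forall f ts, {in ts, forall t, P t} -> P (Fun f ts)) ->
  forall t, P t.
Proof.
move=> PVar PFun; fix IH 1 => -[x|f ts]; first exact: PVar.
apply: PFun; elim: ts => [|t ts IHts] u; first by rewrite in_nil => /notF[].
by rewrite inE => /predU1P[->|]; [apply: IH|apply: IHts].
Qed.

Lemma eq_in_subst s1 s2 t :
  {in vars t, s1 =1 s2} -> subst s1 t = subst s2 t.
Proof.
elim/term_ind_in: t => [x|f ts IH] /= eq_s; first by apply: eq_s; rewrite inE.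
congr Fun; apply/eq_in_map => u u_ts; apply: IH => // x x_u.
by apply: eq_s; apply/flatten_mapP; exists u.
Qed.

Lemma sub_Vars_subst s t x :
  Vars t x -> Vars (s x) `<=` Vars (subst s t).
Proof.
move=> x_t y y_sx; elim/term_ind_in: t x_t => [z|f ts IH]; rewrite /Vars /=.
  by rewrite inE => /eqP <-.
move=> /flatten_mapP[t t_ts /(IH t t_ts) y_t]; rewrite -map_comp.
by apply/flatten_mapP; exists t.
Qed.

Lemma subst_comp s1 s2 t : subst s2 (subst s1 t) = subst (subst s2 \o s1) t.
Proof.
elim/term_ind_in: t => [x|f ts IH] //=.
by rewrite -map_comp; congr Fun; apply/eq_in_map.
Qed.

Lemma subterm_at_subst s t p w :
  subterm_at t p = Some w -> subterm_at (subst s t) p = Some (subst s w).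
Proof.
elim: p t => [|i p IH] [x|f ts] //= => [[<-]|[<-]|] //.
by rewrite onth_map; case: (onth ts i) => //= u /IH.
Qed.

Lemma replace_at_subst s t p w u :
  subterm_at t p = Some w ->
  subst s (replace_at t p u) = replace_at (subst s t) p (subst s u).
Proof.
elim: p t => [|i p IH] [x|f ts] //=.
rewrite onth_map; case: (onth ts i) => //= v /IH <-.
by rewrite map_cat /= map_take map_drop.
Qed.

Definition well_sorted s : Prop := forall x, has_sort (s x) (var_sort x).

Lemma has_sort_subst s t a :
  well_sorted s -> has_sort t a -> has_sort (subst s t) a.
Proof.
move=> s_sorted; elim/term_ind_in: t a => [x|f ts IH] a t_sort.
  by inversion t_sort; subst; apply: s_sorted.
inversion t_sort as [|f' ts' ts_sort]; subst; constructor.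
elim: ts_sort IH => //= t b l l' t_b _ IHl IH; constructor.
  by apply: IH => //; rewrite mem_head.
by apply: IHl => u u_l; apply: IH; rewrite inE u_l orbT.
Qed.

Lemma well_sorted_comp s1 s2 :
  well_sorted s1 -> well_sorted s2 -> well_sorted (subst s2 \o s1).
Proof. by move=> sorted1 sorted2 x; apply: has_sort_subst. Qed.

Lemma finite_Vars t : finite_set (Vars t).
Proof. exact: finite_seq. Qed.

Definition id_subst : substitution Sg.
Proof.
exists (@Var Sg); first exact: has_sort_var.
by apply: (@sub_finite_set _ _ set0) => // x; rewrite /Dom.
Defined.

Lemma exists_override (sigma : substitution Sg) s (D : set (var Sg)) :
  finite_set D -> (forall x, D x -> has_sort (s x) (var_sort x)) ->
  exists sigma' : substitution Sg,
    (forall x, D x -> sigma' x = s x) /\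
    (forall x, ~ D x -> sigma' x = sigma x).
Proof.
move=> finD sortD; pose s' x := if `[< D x >] then s x else sigma x.
have s'_sorted : well_sorted s'.
  by rewrite /s' => x; case: asboolP => [/sortD|_] //; apply: subst_sorted.
have s'_finite : finite_set (Dom s').
  apply: (@sub_finite_set _ _ (D `|` Dom sigma)); last first.
    by rewrite finite_setU; split=> //; apply: subst_finite.
  by rewrite /s' => x; rewrite /Dom /=; case: asboolP => ?; [left|right].
exists (Substitution s'_sorted s'_finite); split=> x Dx /=.
- by rewrite /s' asboolT.
- by rewrite /s' asboolF.
Qed.

End Terms.

Section Values.
Variable Sg : signature.
Implicit Types (X : set (var Sg)) (s : var Sg -> term Sg) (nu : valuation Sg).

Definition value_term (a : value Sg) : term Sg := Fun (ValSym a) [::].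

Lemma has_sort_value_term (a : value Sg) tau :
  has_sort (value_term a) (inl tau) <-> value_sort a = tau.
Proof.
split=> [a_sort|<-]; first by inversion a_sort.
exact: (has_sort_fun (f := ValSym a)).
Qed.

Definition agrees_on X s nu : Prop :=
  forall x, X x -> s x = value_term (nu x).

Lemma agrees_on_sub X Y s nu :
  X `<=` Y -> agrees_on Y s nu -> agrees_on X s nu.
Proof. by move=> XY agree x /XY/agree. Qed.

Lemma agrees_on_valued X s nu : agrees_on X s nu -> valued X s.
Proof. by move=> agree _ [x Xx <-]; exists (nu x); apply: agree. Qed.

Lemma valued_agrees_on (M : model Sg) X (sigma : substitution Sg) :
  valued X sigma -> exists nu, agrees_on X sigma nu.
Proof.
move=> sigmaX.
have /choice[f fP] x : exists a : value Sg,
    (forall tau, var_sort x = inl tau -> value_sort a = tau) /\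
    (X x -> sigma x = value_term a).
  have [Xx|notXx] := pselect (X x).
    have [a sigma_x] : Val (sigma x) by apply: sigmaX; exists x.
    exists a; split=> // tau x_tau; apply/has_sort_value_term.
    by rewrite -x_tau -[value_term a]sigma_x; apply: subst_sorted.
  case x_sort: (var_sort x) => [tau|b]; last by exists (vbool M true).
  have [a a_tau] := carrier_nonempty M tau.
  by exists a; split=> // _ [<-].
exists (Valuation (fun x => proj1 (fP x))) => x Xx.
exact: (proj2 (fP x)).
Qed.

Lemma exists_override_valuation (sigma : substitution Sg) nu X :
  finite_set X -> X `<=` @theory_vars Sg ->
  exists sigma' : substitution Sg,
    agrees_on X sigma' nu /\ (forall x, ~ X x -> sigma' x = sigma x).
Proof.
move=> finX theoryX; apply: exists_override => // x /theoryX[tau x_tau].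
by rewrite x_tau; apply/has_sort_value_term/val_sorted.
Qed.

Lemma exists_value_factorization s X V :
  well_sorted s -> valued X s -> finite_set V -> X `<=` V ->
  exists tau theta : substitution Sg,
    [/\ forall x, X x -> tau x = s x, Dom tau = VDom tau, VDom tau = X
      & forall t, Vars t `<=` V -> subst theta (subst tau t) = subst s t].
Proof.
move=> s_sorted sX finV XV; have finX := sub_finite_set XV finV.
have [tau [tau_s tau_id]] :=
  exists_override (id_subst Sg) finX (fun x _ => s_sorted x).
have [theta [theta_s _]] :=
  exists_override (id_subst Sg) finV (fun x _ => s_sorted x).
have tau_value x : X x -> Val (tau x).
  by move=> Xx; rewrite tau_s //; apply: sX; exists x.
have VDomE : VDom tau = X.
  apply/seteqP; split=> x; last exact: tau_value.
  by apply: contraPP => /tau_id; rewrite /VDom /= => -> [].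
exists tau, theta; split=> // [|t tV].
  apply/seteqP; split=> x; last by rewrite /Dom /VDom /= => -[a ->].
  by rewrite VDomE; apply: contraPP => /tau_id tau_x /(_ tau_x).
rewrite subst_comp; apply: eq_in_subst => x /tV Vx /=.
have [Xx|/tau_id -> /=] := pselect (X x); last exact: theta_s.
by have [a tau_x] := tau_value x Xx; rewrite -tau_s // tau_x.
Qed.

Definition merge (b : pred (var Sg)) (nu mu : valuation Sg) : valuation Sg.
Proof.
exists (fun x => if b x then nu x else mu x).
by move=> x tau x_tau; case: (b x); apply: val_sorted.
Defined.

End Values.

Section Evaluation.
Variables (Sg : signature) (M : model Sg).
Implicit Types (s : var Sg -> term Sg) (t phi psi : term Sg).
Implicit Types (nu : valuation Sg) (f g : var Sg -> value Sg).

Definition satisfies f phi : Prop := eval M f phi = vbool M true.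

Lemma eq_in_eval f g t : {in vars t, f =1 g} -> eval M f t = eval M g t.
Proof.
elim/term_ind_in: t => [x|[a|h|h] ts IH] //= eq_fg.
  by apply: eq_fg; rewrite inE.
congr interp; apply/eq_in_map => u u_ts; apply: IH => // x x_u.
by apply: eq_fg; apply/flatten_mapP; exists u.
Qed.

Lemma eval_subst f s t : eval M f (subst s t) = eval M (eval M f \o s) t.
Proof.
elim/term_ind_in: t => [x|[a|h|h] ts IH] //=.
by rewrite -map_comp; congr interp; apply/eq_in_map.
Qed.

Lemma value_sort_eval nu t tau :
  theory_term t -> has_sort t (inl tau) -> value_sort (eval M nu t) = tau.
Proof.
elim/term_ind_in: t tau => [x|[a|h|h] ts IH] tau //= t_theory t_sort.
- by inversion t_sort as [x' x_sort|]; apply: val_sorted.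
- by inversion t_sort.
- inversion t_sort as [|h' ts' ts_sort]; subst; apply: interp_sort.
  move: ts_sort => /=.
  elim: ts (theory_dom h) t_theory IH {t_sort} => [|u us IHus] [|b bs] /=.
  + by [].
  + by move=> _ _ us_sort; inversion us_sort.
  + by move=> _ _ us_sort; inversion us_sort.
  + move=> /andP[u_theory us_theory] IH us_sort; inversion us_sort; subst.
    congr cons; first by apply: IH; rewrite ?mem_head.
    by apply: IHus => // v v_us; apply: IH; rewrite inE v_us orbT.
Qed.

Lemma eval_constraint nu phi :
  is_constraint phi -> exists b, eval M nu phi = vbool M b.
Proof. by case=> phi_sort phi_theory; apply/(vbool_onto M)/value_sort_eval. Qed.

Lemma is_constraint_andt phi psi :
  is_constraint (andt phi psi) -> is_constraint phi /\ is_constraint psi.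
Proof.
case=> and_sort /= /and3P[phi_theory psi_theory _].
inversion and_sort as [|f ts args_sort]; subst.
move: args_sort; rewrite /= and_dom /= => args_sort.
inversion args_sort as [|? ? ? ? phi_sort args_sort']; subst.
by inversion args_sort' as [|? ? ? ? psi_sort _]; subst.
Qed.

Lemma satisfies_andt nu phi psi :
  is_constraint (andt phi psi) ->
  satisfies nu (andt phi psi) <-> satisfies nu phi /\ satisfies nu psi.
Proof.
rewrite /satisfies => /is_constraint_andt[].
move=> /(eval_constraint nu)[a /= ->] /(eval_constraint nu)[b ->].
rewrite interp_and; split=> [/vbool_inj/andP[-> ->] //|].
by case=> /vbool_inj-> /vbool_inj->.
Qed.

(* Outside theory terms [eval] need not respect sorts, hence the case split. *)
Definition comp_valuation nu (gamma : substitution Sg) : valuation Sg.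
Proof.
exists (fun x => if theory_term (gamma x) then eval M nu (gamma x) else nu x).
move=> x tau x_tau; case: ifP => [gamma_x|_]; last exact: val_sorted.
by apply: value_sort_eval; rewrite // -x_tau; apply: subst_sorted.
Defined.

Lemma eval_comp_valuation nu (gamma : substitution Sg) t :
  {in vars t, forall x, theory_term (gamma x)} ->
  eval M (comp_valuation nu gamma) t = eval M nu (subst gamma t).
Proof.
move=> gamma_theory; rewrite eval_subst.
by apply: eq_in_eval => x /gamma_theory /= ->.
Qed.

Lemma modelsP (X : set (var Sg)) (sigma : substitution Sg) (e : exformula Sg) :
  FVar e `<=` X -> X `&` BVar e = set0 ->
  valued X sigma /\ models M sigma e <->
  exists nu, agrees_on X sigma nu /\ satisfies nu (body e).
Proof.
move=> FX XB; split=> [[sigmaX [_ e_valid]]|[nu [agree nu_e]]].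
- have [mu agree] := valued_agrees_on M sigmaX.
  have [nu [/= nu_mu nu_e]] := e_valid mu.
  have agree' : agrees_on X sigma nu.
    move=> x Xx; rewrite nu_mu; first exact: agree.
    by apply/negP => Bx; have : set0 x by rewrite -XB.
  exists nu; split=> //; rewrite /satisfies -nu_e eval_subst.
  apply: eq_in_eval => x x_e /=; case: ifP => // /negP x_free.
  by rewrite agree' //; apply: FX.
- split; first exact: agrees_on_valued agree.
  split; first exact: agrees_on_valued (agrees_on_sub FX agree).
  move=> mu; exists (merge [in bvars e] nu mu); split=> [x /= /negbTE-> //|].
  rewrite -nu_e /= eval_subst; apply: eq_in_eval => x x_e /=.
  case: ifP => [/= ->//|/negP x_free].
  by rewrite agree //; apply: FX.
Qed.

Lemma cterm_interpP (S : cterm Sg) u :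
  cterm_interp M S u <->
  exists (sigma : substitution Sg) nu,
    [/\ u = subst sigma (ct_term S), agrees_on (ct_set S) sigma nu
      & satisfies nu (body (ct_con S))].
Proof.
have XB : ct_set S `&` BVar (ct_con S) = set0.
  by rewrite setIC; apply: subsetI_eq0 (ct_bvar S); last exact: ct_set_vars.
have instanceP sigma := modelsP sigma (@ct_fvar _ S) XB.
split=> [[sigma [-> sigmaX sigma_con]]|[sigma [nu [-> agree nu_con]]]].
- have [nu [agree nu_con]] := (instanceP sigma).1 (conj sigmaX sigma_con).
  by exists sigma, nu.
- have [] := (instanceP sigma).2 (ex_intro _ nu (conj agree nu_con)).
  by exists sigma.
Qed.

End Evaluation.

Section RuleInterpretation.
Variables (Sg : signature) (M : model Sg).
Implicit Types (rho : rule Sg) (u v : term Sg) (s : var Sg -> term Sg).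

Lemma sub_step (P Q : set (term Sg * term Sg)) u v :
  P `<=` Q -> step P u v -> step Q u v.
Proof.
by move=> PQ [p [l [r [theta [/PQ Qlr ul vr]]]]]; exists p, l, r, theta.
Qed.

Definition interp_vars rho : set (var Sg) :=
  rl_set rho `&` (Vars (rl_lhs rho) `|` Vars (rl_rhs rho)).

Definition rule_exformula rho : exformula Sg :=
  Ex (vars_diff (vars (rl_con rho)) (vars (rl_lhs rho) ++ vars (rl_rhs rho)))
     (rl_con rho).

Lemma in_vars_diff (xs ys : seq (var Sg)) x :
  (x \in vars_diff xs ys) = (x \in xs) && (x \notin ys).
Proof. by rewrite mem_filter mem_undup andbC. Qed.

Lemma FVar_rule_exformula rho : FVar (rule_exformula rho) `<=` interp_vars rho.
Proof.
move=> x [/= x_con]; rewrite /BVar /= in_vars_diff x_con mem_cat /=.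
move=> /negP/negPn/orP x_lr; split=> //.
by apply: rl_vars; left.
Qed.

Lemma interp_vars_BVar rho :
  interp_vars rho `&` BVar (rule_exformula rho) = set0.
Proof.
apply/disjoints_subset => x [_ x_lr]; rewrite /BVar /= in_vars_diff mem_cat.
by move=> /andP[_ /negP]; apply; apply/orP.
Qed.

Definition respects s rho (kappa : valuation Sg) : Prop :=
  agrees_on (interp_vars rho) s kappa /\ satisfies M kappa (rl_con rho).

(* Unlike the two substitutions into which [rule_interp] and [step] split it,
   [s] need not have a finite domain, so it can be composed with a renaming. *)
Lemma step_rule_interpP rho u v :
  step (rule_interp M rho) u v <->
  exists (p : seq nat) s (kappa : valuation Sg),
    [/\ well_sorted s, respects s rho kappa,
        subterm_at u p = Some (subst s (rl_lhs rho))
      & v = replace_at u p (subst s (rl_rhs rho))].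
Proof.
have instanceP tau :=
  modelsP M tau (@FVar_rule_exformula rho) (@interp_vars_BVar rho).
split=> [|[p [s [kappa [s_sorted [agree kappa_con] ul vr]]]]].
- move=> [p [_ [_ [theta [[tau [[-> ->] _ VDomE tau_con]] ul vr]]]]].
  have [|kappa [agree kappa_con]] := (instanceP tau).1 (conj _ tau_con).
    move=> _ [x x_interp <-].
    by suff : VDom tau x by []; rewrite VDomE.
  exists p, (subst theta \o tau), kappa; rewrite -!subst_comp; split=> //.
    by apply: well_sorted_comp; apply: subst_sorted.
  by split=> // x /agree /= ->.
- have finV : finite_set (Vars (rl_lhs rho) `|` Vars (rl_rhs rho)).
    by rewrite finite_setU; split; apply: finite_Vars.
  have [tau [theta [tau_s DomE VDomE substE]]] := exists_value_factorization
    s_sorted (agrees_on_valued agree) finV (@subIsetr _ _ _).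
  exists p, (subst tau (rl_lhs rho)), (subst tau (rl_rhs rho)), theta.
  rewrite !substE; [|exact: subsetUr|exact: subsetUl].
  split=> //; exists tau; split=> //.
  have [|//] := (instanceP tau).2; exists kappa; split=> // x x_interp.
  by rewrite tau_s ?agree.
Qed.

Lemma step_variant rho rho' u v :
  is_variant rho rho' -> step (rule_interp M rho') u v ->
  step (rule_interp M rho) u v.
Proof.
case=> delta [_ delta_sort setE [lhsE rhsE conE]] /step_rule_interpP.
move=> [p [s [kappa [s_sorted [agree kappa_con] ul vr]]]].
have kappa_sort x tau : var_sort x = inl tau ->
    value_sort ((kappa \o delta) x) = tau.
  by rewrite -delta_sort; apply: val_sorted.
have Vars_rename t x : Vars t x ->
    Vars (subst (fun y => Var (delta y)) t) (delta x).
  by move=> /sub_Vars_subst; apply; apply: mem_head.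
apply/step_rule_interpP; exists p, (s \o delta), (Valuation kappa_sort).
split.
- by move=> x; rewrite -delta_sort; apply: s_sorted.
- split=> [x [x_set x_lr]|] /=.
    apply: agree; split; first by rewrite setE; exists x.
    by rewrite lhsE rhsE; case: x_lr => /Vars_rename; [left|right].
  by rewrite /satisfies -kappa_con conE eval_subst.
- by rewrite ul lhsE subst_comp.
- by rewrite vr rhsE subst_comp.
Qed.

End RuleInterpretation.

Section MostGeneralStep.
Variables (Sg : signature) (M : model Sg).
Implicit Types (S T : cterm Sg) (rho : rule Sg) (p : seq nat).
Implicit Types (gamma sigma : substitution Sg) (nu : valuation Sg).

Lemma redex_step S rho p gamma sigma nu :
  is_redex M S rho p gamma ->
  agrees_on (ct_set S `|` ExVar rho) sigma nu ->
  satisfies M nu (subst gamma (rl_con rho)) ->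
  step (rule_interp M rho) (subst sigma (ct_term S))
    (subst sigma (replace_at (ct_term S) p (subst gamma (rl_rhs rho)))).
Proof.
move=> [DomE redex gamma_set _] agree nu_con.
have gamma_id x : ~ Vars (rl_lhs rho) x -> gamma x = Var x.
  by rewrite -DomE => /contrapT.
have gamma_theory x : rl_set rho x -> theory_term (gamma x).
  move=> x_set; have [x_l|/gamma_id-> //] := pselect (Vars (rl_lhs rho) x).
  by have [[a ->]|[y _ <-]] := gamma_set x (conj x_l x_set).
apply/step_rule_interpP.
exists p, (subst sigma \o gamma), (comp_valuation M nu gamma).
rewrite -!subst_comp (replace_at_subst _ _ redex) (subterm_at_subst _ redex).
split=> //; first by apply: well_sorted_comp; apply: subst_sorted.
split=> [x [x_set x_lr]|]; last first.
  rewrite /satisfies eval_comp_valuation // => x x_con.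
  by apply: gamma_theory; apply: rl_vars; left.
rewrite /= gamma_theory //.
have [x_l|x_notl] := pselect (Vars (rl_lhs rho) x).
  have [[a ->] //|[y y_S <-] /=] := gamma_set x (conj x_l x_set).
  by apply: agree; left.
rewrite gamma_id //=; apply: agree; right; split=> //.
by case: x_lr.
Qed.

Lemma mg_step_ExVar_sub rho p gamma S T :
  mg_step M rho p gamma S T -> ExVar rho `<=` Vars (ct_term T).
Proof.
by move=> [_ [_ _ _ setE]] x x_ex; apply: ct_set_vars; rewrite setE; left.
Qed.

Lemma mg_step_satisfies rho p gamma S T nu :
  mg_step M rho p gamma S T ->
  satisfies M nu (body (ct_con T)) <->
  satisfies M nu (body (ct_con S)) /\ satisfies M nu (subst gamma (rl_con rho)).
Proof.
move=> [_ [_ bodyE _ _]]; rewrite bodyE; apply: satisfies_andt.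
by rewrite -bodyE; have [] := ct_con_wf T.
Qed.

Lemma mg_step_instance rho p gamma S T sigma nu :
  mg_step M rho p gamma S T ->
  agrees_on (ct_set S `|` ExVar rho) sigma nu ->
  satisfies M nu (body (ct_con T)) ->
  [/\ cterm_interp M S (subst sigma (ct_term S)),
      cterm_interp M T (subst sigma (ct_term T))
    & step (rule_interp M rho)
        (subst sigma (ct_term S)) (subst sigma (ct_term T))].
Proof.
move=> mg agree nu_T; have [[_ _ _ redex] [termE _ _ setE]] := mg.
have [nu_S nu_con] := (mg_step_satisfies nu mg).1 nu_T.
split.
- apply/cterm_interpP; exists sigma, nu; split=> //.
  by apply: agrees_on_sub agree; apply: subsetUl.
- apply/cterm_interpP; exists sigma, nu; split=> //.
  apply: agrees_on_sub agree; rewrite setE setUC.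
  by apply: setSU; apply: subIsetl.
- by rewrite termE; apply: redex_step redex agree nu_con.
Qed.

Lemma mg_step_fresh rho p gamma S T x :
  mg_step M rho p gamma S T -> rule_vars rho x ->
  ~ (Vars (ct_term S) `|` Vars (body (ct_con S))) x.
Proof. by move=> [[_ _ /disjoints_subset fresh _] _]; apply: fresh. Qed.

Lemma mg_step_witness rho p gamma S T nu :
  mg_step M rho p gamma S T -> satisfies M nu (body (ct_con S)) ->
  exists mu : valuation Sg,
    (forall x, (Vars (ct_term S) `|` Vars (body (ct_con S))) x ->
       mu x = nu x) /\
    satisfies M mu (body (ct_con T)).
Proof.
move=> mg nu_S; have [[_ _ _ [_ _ _ S_con]] _] := mg.
have [|mu [/= mu_nu mu_con]] := S_con nu; first by exists nu.
have {}mu_nu x : (Vars (ct_term S) `|` Vars (body (ct_con S))) x -> mu x = nu x.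
  move=> x_S; apply: mu_nu; rewrite in_vars_diff; apply/negP => /andP[x_con _].
  by apply: mg_step_fresh mg _ x_S; right.
exists mu; split=> //; apply/(mg_step_satisfies mu mg); split=> //.
rewrite /satisfies -nu_S; apply: eq_in_eval => x x_S.
by apply: mu_nu; right.
Qed.

Lemma mg_step_forward rho p gamma S T u :
  mg_step M rho p gamma S T -> cterm_interp M S u ->
  exists v, cterm_interp M T v /\ step (rule_interp M rho) u v.
Proof.
move=> mg /cterm_interpP[sigma [nu [-> agree nu_S]]].
have [mu [mu_nu mu_T]] := mg_step_witness mg nu_S.
have ExVar_theory : ExVar rho `<=` @theory_vars Sg.
  by move=> x x_ex; apply: (@rl_set_theory _ rho); apply: rl_vars; right.
have ExVar_finite : finite_set (ExVar rho).
  by apply: finite_setD; apply: finite_Vars.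
have [sigma' [agree' sigma'E]] :=
  exists_override_valuation sigma mu ExVar_finite ExVar_theory.
have sigma'S x : Vars (ct_term S) x -> sigma' x = sigma x.
  move=> x_S; apply: sigma'E => -[x_r _].
  by apply: (mg_step_fresh (x := x) mg); [left; right|left].
have agreeS : agrees_on (ct_set S `|` ExVar rho) sigma' mu.
  move=> x [x_S|/agree' //]; have x_s := ct_set_vars x_S.
  by rewrite sigma'S // mu_nu ?agree //; left.
have [_ T_v uv] := mg_step_instance mg agreeS mu_T.
exists (subst sigma' (ct_term T)); split=> //.
by rewrite -(eq_in_subst sigma'S).
Qed.

Lemma mg_step_backward rho p gamma S T v :
  mg_step M rho p gamma S T -> cterm_interp M T v ->
  exists u, cterm_interp M S u /\ step (rule_interp M rho) u v.
Proof.
move=> mg /cterm_interpP[sigma [nu [-> agree nu_T]]].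
have [_ [_ _ _ setE]] := mg.
pose lost := ct_set S `\` Vars (ct_term T).
have lost_theory : lost `<=` @theory_vars Sg by move=> x [/ct_set_theory].
have lost_finite : finite_set lost.
  apply: finite_setD.
  exact: sub_finite_set (@ct_set_vars _ S) (finite_Vars _).
have [sigma' [agree' sigma'E]] :=
  exists_override_valuation sigma nu lost_finite lost_theory.
have sigma'T x : Vars (ct_term T) x -> sigma' x = sigma x.
  by move=> x_T; apply: sigma'E => -[].
have agreeS : agrees_on (ct_set S `|` ExVar rho) sigma' nu.
  move=> x x_S; have [x_T|x_notT] := pselect (Vars (ct_term T) x).
    by rewrite sigma'T // agree // setE; case: x_S; [right|left].
  by case: x_S => [x_S|/(mg_step_ExVar_sub mg) //]; apply: agree'.
have [S_u _ uv] := mg_step_instance mg agreeS nu_T.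
exists (subst sigma' (ct_term S)); split=> //.
by rewrite -(eq_in_subst sigma'T).
Qed.

End MostGeneralStep.

Section EgliMilner.
Variable A : Type.
Implicit Types (r : A -> A -> Prop) (U V W : set A).

Definition egli_milner r U V : Prop :=
  (forall u, U u -> exists v, V v /\ r u v) /\
  (forall v, V v -> exists u, U u /\ r u v).

Lemma egli_milner_sub r1 r2 U V :
  (forall u v, r1 u v -> r2 u v) -> egli_milner r1 U V -> egli_milner r2 U V.
Proof.
move=> r12 [fwd bwd]; split=> [u /fwd[v [Vv uv]]|v /bwd[u [Uu uv]]].
- by exists v; split; last exact: r12.
- by exists u; split; last exact: r12.
Qed.

Lemma egli_milner_refl r U : (forall u, r u u) -> egli_milner r U U.
Proof. by move=> r_refl; split=> u Uu; exists u. Qed.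

Lemma egli_milner_trans r U V W :
  (forall u v w, r u v -> r v w -> r u w) ->
  egli_milner r U V -> egli_milner r V W -> egli_milner r U W.
Proof.
move=> r_trans [fwdUV bwdUV] [fwdVW bwdVW]; split.
- move=> u /fwdUV[v [/fwdVW[w [Ww vw]] uv]].
  by exists w; split; last exact: r_trans uv vw.
- move=> w /bwdVW[v [/bwdUV[u [Uu uv]] vw]].
  by exists u; split; last exact: r_trans uv vw.
Qed.

End EgliMilner.

Lemma cstep_egli_milner (Sg : signature) (M : model Sg) (R : set (rule Sg))
    (S T : cterm Sg) :
  cstep M R S T ->
  egli_milner (step (rules_interp M R)) (cterm_interp M S) (cterm_interp M T).
Proof.
move=> [rho [R_rho [rho' [p [gamma [variant mg]]]]]].
apply: (@egli_milner_sub _ (step (rule_interp M rho'))) => [u v uv|].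
  apply: (@sub_step _ (rule_interp M rho)); last exact: step_variant uv.
  by move=> lr lr_rho; exists rho.
by split=> [u|v]; [apply: mg_step_forward mg|apply: mg_step_backward mg].
Qed.

Theorem theorem4p10 (Sg : signature) (M : model Sg) (R : set (rule Sg))
    (hR : is_LCTRS M R) (S T : cterm Sg) (hST : csteps M R S T) :
  (forall u : term Sg, cterm_interp M S u ->
     exists v : term Sg, cterm_interp M T v /\ steps (rules_interp M R) u v) /\
  (forall v : term Sg, cterm_interp M T v ->
     exists u : term Sg, cterm_interp M S u /\ steps (rules_interp M R) u v).
Proof.
change (egli_milner (steps (rules_interp M R))
  (cterm_interp M S) (cterm_interp M T)).
elim: hST => [S1 S2 step12|S1|S1 S2 S3 _ steps12 _ steps23].
- by apply: egli_milner_sub (cstep_egli_milner step12); apply: rt_step.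
- by apply: egli_milner_refl; apply: rt_refl.
- by apply: egli_milner_trans steps12 steps23; apply: rt_trans.
Qed.
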